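(* Let $q\ge 2$. There is no $u\in C^{6}(\mathbb{R}^{4})$ with $u>0$ solving $\Delta^{3}u=u^{-q}$ in $\mathbb{R}^{4}$ and satisfying $u(x)=o(|x|^{4})$ as $|x|\to+\infty$. *)

(* Defs.v *)
From HB Require Import structures.
From mathcomp Require Import all_boot all_order all_algebra.
From mathcomp Require Import all_classical all_reals all_analysis.
Set Implicit Arguments. Unset Strict Implicit. Unset Printing Implicit Defensive.
Import Order.TTheory GRing.Theory Num.Theory.
Import numFieldNormedType.Exports.
Local Open Scope ring_scope.

Definition basis_vec (R : realType) (n : nat) (i : 'I_n) : 'rV[R]_n :=
  delta_mx 0 i.

Definition partial (R : realType) (n : nat) (i : 'I_n)
  (f : 'rV[R]_n -> R) : 'rV[R]_n -> R :=
  fun x => 'D_(basis_vec R i) f x.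

Fixpoint Ck (R : realType) (n : nat) (k : nat) (f : 'rV[R]_n -> R) : Prop :=
  match k with
  | 0 => continuous f
  | k'.+1 => continuous f /\
      forall i : 'I_n, (forall x, derivable f x (basis_vec R i)) /\
                       Ck k' (partial i f)
  end.

Definition laplacian (R : realType) (n : nat) (f : 'rV[R]_n -> R) :
  'rV[R]_n -> R :=
  fun x => \sum_(i < n) partial i (partial i f) x.

Definition enorm (R : realType) (n : nat) (x : 'rV[R]_n) : R :=
  Num.sqrt (\sum_(i < n) x ord0 i ^+ 2).

(* Main.v *)
Require Import Defs.
From HB Require Import structures.
From mathcomp Require Import all_boot all_order all_algebra.
From mathcomp Require Import all_classical all_reals all_analysis.
From mathcomp Require Import ring lra zify.
Set Implicit Arguments. Unset Strict Implicit. Unset Printing Implicit Defensive.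
Import Order.TTheory GRing.Theory Num.Theory.
Import numFieldNormedType.Exports.
Local Open Scope ring_scope.
Local Open Scope classical_set_scope.

(* Write s_+ for the positive part and put, for j = 0, 1, 2, 3,
     A_j(s) = int_{R^4} (lap^j u) (s - |x|^2)_+^3 dx.
   Green's identity in dimension 4 reads
     A_{j+1} = 4 (s A_j'' - 4 A_j') = 4 s^5 B_j',  where B_j = A_j' / s^4.
   Now A_0 >= 0, A_0 = o(s^7) because u = o(|x|^4), and A_3 >= c s^3 because
   lap^3 u > 0; these facts are contradictory.  Indeed B_2 is increasing; were
   it positive somewhere, integrating up the chain would give A_0 >= k s^7.  So
   B_2 <= 0, and B_2' >= c / s^2 forces B_2 <= - c / s, whence A_2 <= - k s^4
   and B_1' <= - k / s.  Thus B_1 tends to -oo logarithmically, and integrating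
   once more makes A_0 negative.

   Only linearity, positivity, the size of boxes and the vanishing of integrals
   of derivatives are used.  So the integral is replaced by a limit of Riemann
   sums along an ultrafilter, which needs no measurability and no Fubini. *)

(** * Growth of iterated primitives *)

Lemma is_derive_ge0_le (R : realType) (F dF : R -> R) (a : R) :
  (forall s : R, a <= s -> is_derive s 1 F (dF s)) ->
  (forall s, a <= s -> 0 <= dF s) ->
  forall x y, a <= x -> x <= y -> F x <= F y.
Proof.
move=> FdF dF0 x y ax xy.
have [||c] := @MVT_segment R F dF x y xy.
- by move=> z /[!in_itv]/= /andP[xz _]; apply: FdF; lra.
- apply: derivable_within_continuous => z /[!in_itv]/= /andP[xz _].
  by apply: ex_derive; apply: FdF; lra.
rewrite in_itv/= => /andP[xc _] E.
by rewrite -subr_ge0 E mulr_ge0 ?dF0 ?subr_ge0//; lra.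
Qed.

(** Only an eventual lower bound is recorded; divergence to minus infinity is expressed by applying
    it to the opposite function. *)
Definition grows (R : realType) (F : R -> R) (m : nat) :=
  exists k s0 : R, [/\ 0 < k, 0 < s0 & forall s, s0 <= s -> k * s ^+ m <= F s].

(** Subtracting from [F] the primitive of [k * s ^+ m] leaves a function nondecreasing from [s0] on,
    hence bounded below; half of the leading term then absorbs the constant. *)
Lemma grows_primitive (R : realType) (F dF : R -> R) (m : nat) :
  (forall s : R, 0 < s -> is_derive s 1 F (dF s)) -> grows dF m -> grows F m.+1.
Proof.
move=> FdF [k [s0 [k0 s00 dFk]]].
pose l := k / m.+1%:R.
have l0 : 0 < l by rewrite divr_gt0.
pose G := F - l \*: (@id R ^+ m.+1).
have Gle : forall x y, s0 <= x -> x <= y -> G x <= G y.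
  apply: (@is_derive_ge0_le _ G (fun s => dF s - k * s ^+ m)) => s s0s.
    have s_gt0 : 0 < s by lra.
    have := FdF s s_gt0 => dFs.
    apply: is_derive_eq; rewrite /= /GRing.scale/= mulr1 /l.
    by field; rewrite lt0r_neq0// ltr0Sn.
  by rewrite subr_ge0 dFk.
pose C := `|G s0|.
pose s1 := Num.max s0 (Num.max 1 (2 * C / l)).
exists (l / 2), s1; split; first by lra.
  by rewrite lt_max s00.
move=> s; rewrite !ge_max => /andP[s0s /andP[s1s Cs]].
have Gs := Gle s0 s (lexx _) s0s.
have C1 : - C <= G s0 by have := ler_norm (- G s0); rewrite normrN -/C; lra.
have C2 : 2 * C <= l * s by rewrite -ler_pdivrMl// mulrC.
have sm : s <= s ^+ m.+1 by rewrite ler_eXnr.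
have lsm : l * s <= l * s ^+ m.+1 by rewrite ler_pM2l.
have : G s = F s - l * s ^+ m.+1 by rewrite /G !fctE.
lra.
Qed.

Lemma grows_mulX (R : realType) (F : R -> R) (m n : nat) :
  grows F m -> grows (fun s => s ^+ n * F s) (n + m).
Proof.
move=> [k [s0 [k0 s00 Fk]]]; exists k, s0; split => // s s0s.
by rewrite exprD mulrCA ler_wpM2l ?Fk// exprn_ge0//; lra.
Qed.

Lemma grows_divX (R : realType) (F : R -> R) (m n : nat) (c : R) : 0 < c ->
  grows F (n + m) -> grows (fun s => F s / (c * s ^+ n)) m.
Proof.
move=> c0 [k [s0 [k0 s00 Fk]]]; exists (k / c), s0; split => //.
  by rewrite divr_gt0.
move=> s s0s; have s_gt0 : 0 < s by lra.
have cs0 : 0 < c * s ^+ n by rewrite mulr_gt0// exprn_gt0.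
rewrite ler_pdivlMr//; apply: le_trans (Fk _ s0s); rewrite exprD.
rewrite le_eqVlt; apply/orP; left; apply/eqP.
by field; rewrite lt0r_neq0.
Qed.

(* Apply with [A j s] and [B j s] the functions A_j and B_j of the header. *)
Lemma radial_chain_absurd (R : realType) (A B : nat -> R -> R) :
  (forall j (s : R), (j < 3)%N -> 0 < s -> is_derive s 1 (A j) (s ^+ 4 * B j s)) ->
  (forall j (s : R), (j < 3)%N -> 0 < s ->
     is_derive s 1 (B j) (A j.+1 s / (4 * s ^+ 5))) ->
  (forall s, 0 <= A 0%N s) -> ~ grows (A 0%N) 7 -> grows (A 3%N) 3 -> False.
Proof.
move=> dA dB A0 nA07 A3.
(* Passing from [B j.+1] to [B j] gains one power of s: multiplying by s^4 and integrating turns m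
   into 5 + m, then dividing by s^5 and integrating gives m + 1. *)
have up j m : (j < 3)%N -> grows (B j) m -> grows (A j) (5 + m).
  move=> j3 Bm; apply: grows_primitive (fun s => dA j s j3) _.
  exact: (@grows_mulX _ _ m 4).
have up' j m : (j < 3)%N -> grows (A j.+1) (5 + m) -> grows (B j) m.+1.
  move=> j3 Bm; apply: grows_primitive (fun s => dB j s j3) _.
  exact: grows_divX.
(* The chain is linear, so the opposite functions satisfy it too and lower bounds propagate along
   them in the same way. *)
have dNA j (s : R) : (j < 3)%N -> 0 < s ->
    is_derive s 1 (- A j) (s ^+ 4 * (- B j) s).
  move=> j3 s0; have := dA j s j3 s0 => ?.
  by apply: is_derive_eq; rewrite -mulrN.
have dNB j (s : R) : (j < 3)%N -> 0 < s ->
     is_derive s 1 (- B j) ((- A j.+1) s / (4 * s ^+ 5)).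
  move=> j3 s0; have := dB j s j3 s0 => ?.
  by apply: is_derive_eq; rewrite mulNr.
have dn j m : (j < 3)%N -> grows (- B j) m -> grows (- A j) (5 + m).
  move=> j3 Bm; apply: grows_primitive (fun s => dNA j s j3) _.
  exact: (@grows_mulX _ _ m 4).
have dn' j m : (j < 3)%N -> grows (- A j.+1) (5 + m) -> grows (- B j) m.+1.
  move=> j3 Bm; apply: grows_primitive (fun s => dNB j s j3) _.
  exact: grows_divX.
case: A3 => c [s0 [c0 s00 A3]].
have dB2 s : s0 <= s -> c / 4 * s ^- 2 <= A 3%N s / (4 * s ^+ 5).
  move=> s0s; have s_gt0 : 0 < s by lra.
  rewrite ler_pdivlMr ?mulr_gt0 ?exprn_gt0//; apply: le_trans (A3 _ s0s).
  rewrite le_eqVlt; apply/orP; left; apply/eqP; field.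
  by rewrite lt0r_neq0.
have B2_mono : forall x y, s0 <= x -> x <= y -> B 2%N x <= B 2%N y.
  apply: (@is_derive_ge0_le _ (B 2%N) (fun s => A 3%N s / (4 * s ^+ 5))) => s s0s.
    by apply: dB => //; lra.
  apply: le_trans (dB2 _ s0s); rewrite mulr_ge0//; first lra.
  by rewrite invr_ge0 exprn_ge0//; lra.
have B2_le0 s : s0 <= s -> B 2%N s <= 0.
  move=> s0s; rewrite leNgt; apply/negP => B2s; apply: nA07.
  have s_gt0 : 0 < s by lra.
  apply: (up 0%N 2) => //; apply: (up' 0%N 1%N) => //.
  apply: (up 1%N 1%N) => //; apply: (up' 1%N 0%N) => //; apply: (up 2%N 0%N) => //.
  exists (B 2%N s), s; split => // t st; rewrite expr0 mulr1.
  exact: B2_mono.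
have B2c s : s0 <= s -> c / 8 * s^-1 <= - B 2%N s.
  move=> s0s; have s_gt0 : 0 < s by lra.
  have s2 : s0 <= 2 * s by lra.
  (* [G] is nondecreasing. Comparing s with 2s, where [B 2] is still nonpositive, leaves c/(4s) -
     c/(8s) = c/(8s) and avoids a limit at infinity. *)
  pose G := B 2%N + (c / 4) \*: (@GRing.inv R).
  have : G s <= G (2 * s).
    have : forall x y, s0 <= x -> x <= y -> G x <= G y; last by apply => //; lra.
    apply: (@is_derive_ge0_le _ G
      (fun s => A 3%N s / (4 * s ^+ 5) - c / 4 * s ^- 2)) => t s0t.
      have t_gt0 : 0 < t by lra.
      have t_neq0 : t != 0 by rewrite lt0r_neq0.
      have := dB 2%N t isT t_gt0 => ?.
      have ? := is_deriveV t_neq0 (is_derive_id t 1).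
      apply: is_derive_eq; rewrite /= /GRing.scale/= mulr1.
      by field.
    by rewrite subr_ge0 dB2.
  have : G s = B 2%N s + c / 4 * s^-1 by rewrite /G !fctE.
  have : G (2 * s) = B 2%N (2 * s) + c / 4 * (2 * s)^-1 by rewrite /G !fctE.
  have -> : c / 4 * (2 * s)^-1 = c / 8 * s^-1 by field; rewrite lt0r_neq0.
  have := B2_le0 _ s2; lra.
have NA2 : grows (- A 2%N) 4.
  apply: grows_primitive (fun s => dNA 2%N s isT) _.
  exists (c / 8), s0; split => //; first by lra.
  move=> s s0s; have s_gt0 : 0 < s by lra.
  have -> : c / 8 * s ^+ 3 = s ^+ 4 * (c / 8 * s^-1).
    by field; rewrite lt0r_neq0.
  by rewrite ler_wpM2l ?B2c// exprn_ge0//; lra.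
have NB1 : grows (- B 1%N) 0.
  case: NA2 => k [s1 [k0 s10 NA2]].
  (* The derivative of [- B 1] is only bounded below by a multiple of 1/s, an exponent that [grows]
     cannot express; hence the explicit comparison with [ln]. *)
  pose G := - B 1%N - (k / 4) \*: (@ln R).
  have Gle : forall x y, s1 <= x -> x <= y -> G x <= G y.
    apply: (@is_derive_ge0_le _ G
      (fun s => (- A 2%N) s / (4 * s ^+ 5) - k / 4 * s^-1)) => t s1t.
      have t_gt0 : 0 < t by lra.
      have := dNB 1%N t isT t_gt0 => ?.
      have ? := is_derive1_ln t_gt0.
      by apply: is_derive_eq.
    have t_gt0 : 0 < t by lra.
    rewrite subr_ge0 ler_pdivlMr ?mulr_gt0 ?exprn_gt0//.
    apply: le_trans (NA2 _ s1t).
    rewrite le_eqVlt; apply/orP; left; apply/eqP; field.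
    by rewrite lt0r_neq0.
  (* Beyond this threshold (k/4) ln s is at least 1 - [G s1], which makes [- B 1] at least 1. *)
  pose s2 := Num.max s1 (expR ((1 - G s1) / (k / 4))).
  have s20 : 0 < s2 by rewrite lt_max s10.
  exists 1, s2; split => // s s2s; rewrite expr0 mulr1.
  have := s2s; rewrite ge_max => /andP[s1s es].
  have k4 : 0 < k / 4 by lra.
  have lns : 1 - G s1 <= k / 4 * ln s.
    rewrite mulrC -ler_pdivrMr// -[leLHS]expRK ler_ln// posrE ?expR_gt0//.
    by lra.
  have := Gle s1 s (lexx _) s1s.
  have : G s = (- B 1%N) s - k / 4 * ln s by rewrite /G !fctE.
  lra.
have [k [s1 [k0 s10 kA]]] : grows (- A 0%N) 6.
  apply: (dn 0%N 1) => //; apply: (dn' 0%N 0%N) => //.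
  exact: (dn 1%N 0%N).
have := kA s1 (lexx _).
have : 0 < k * s1 ^+ 6 by rewrite mulr_gt0// exprn_gt0.
have : (- A 0%N) s1 = - A 0%N s1 by [].
have := A0 s1; lra.
Qed.

(** * Riemann sums on a lattice *)

(** Compactness of [-K, K] provides a cluster point, and an ultrafilter converges to each of its
    cluster points. *)
Lemma ultra_bounded_cvg (R : realType) (U : set_system nat) (f : nat -> R)
    (K : R) :
  UltraFilter U -> (forall m, `|f m| <= K) -> cvg (f @ U).
Proof.
move=> UU fK.
have fKU : (f @ U) `[- K, K].
  rewrite /fmap/= /nbhs/=; apply: filterS filterT => m _ /=.
  by rewrite in_itv/= -ler_norml.
have [p [_ clp]] := @segment_compact R (- K) K (f @ U) _ fKU.
apply/cvg_ex; exists p => V pV.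
have [//|UnV] := in_ultra_setVsetC (f @^-1` V) UU.
by have [y [nVy Vy]] := clp (~` V) V UnV pV.
Qed.

Section lattice.
Context {R : realType} {n : nat}.
Implicit Types (f g : 'rV[R]_n -> R) (r m : nat).

Definition box r (x : 'rV[R]_n) : bool := [forall i, `|x ord0 i| <= r%:R].

Definition cube (x : 'rV[R]_n) : bool := [forall i, 0 <= x ord0 i <= 1].

Definition bounded_support g :=
  exists (C : R) r, forall x, `|g x| <= C * (box r x)%:R.

(** With N = (m+1)^2, the indices 0, ..., 2N - 1 describe the points of mesh 1/(m+1) in [-(m+1),
    m+1), so one parameter both refines the mesh and enlarges the window. *)
Definition lattice_index m := {ffun 'I_n -> 'I_(2 * (m.+1 * m.+1))}.

Definition lattice_pt m (k : lattice_index m) : 'rV[R]_n :=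
  \row_i (((k i)%:R - (m.+1 * m.+1)%:R) / m.+1%:R).

Definition riemann_sum m g : R :=
  (m.+1%:R ^+ n)^-1 * \sum_(k : lattice_index m) g (lattice_pt k).

Lemma box_le r r' (x : 'rV[R]_n) : (r <= r')%N -> box r x -> box r' x.
Proof.
move=> rr' /forallP xr; apply/forallP => i; apply: le_trans (xr i) _.
by rewrite ler_nat.
Qed.

Lemma sum_ord_itv (a b K : nat) :
  (\sum_(j < K) (a <= j <= b) = minn K b.+1 - a)%N.
Proof.
elim: K => [|K IH]; first by rewrite big_ord0; lia.
rewrite big_ord_recr/= IH; lia.
Qed.

(** The indicator of a product set is a product of indicators, so the sum over the lattice is the
    n-th power of a count of indices in one coordinate. *)
Lemma riemann_sum_prod m (c : pred R) (a b : nat) :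
  (forall j : nat, (j < 2 * (m.+1 * m.+1))%N ->
     c ((j%:R - (m.+1 * m.+1)%:R) / m.+1%:R) = (a <= j <= b)%N) ->
  riemann_sum m (fun x => [forall i, c (x ord0 i)]%:R) =
  ((minn (2 * (m.+1 * m.+1)) b.+1 - a)%N%:R / m.+1%:R) ^+ n.
Proof.
move=> cE; rewrite /riemann_sum expr_div_n mulrC; congr (_ / _).
transitivity (\sum_(k : lattice_index m) \prod_i ((a <= k i <= b)%N : nat)%:R : R).
  apply: eq_bigr => k _; rewrite -natr_prod; congr (_%:R).
  transitivity (\prod_i nat_of_bool (a <= k i <= b)%N)%N; last by [].
  case: (boolP [forall _, _]) => [/forallP H|].
    by rewrite big1// => i _; have := H i; rewrite mxE cE// => ->.
  rewrite negb_forall => /existsP[i]; rewrite mxE cE// => Hi.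
  by rewrite (bigD1 i)//= (negbTE Hi).
rewrite -(bigA_distr_bigA
  (fun (_ : 'I_n) (j : 'I_(2 * (m.+1 * m.+1))) => ((a <= j <= b)%N : nat)%:R : R)).
by rewrite -natr_sum sum_ord_itv prodr_const card_ord.
Qed.

Lemma riemann_sum_box m r : (0 < r)%N ->
  riemann_sum m (fun x => (box r x)%:R) <= (3 * r)%:R ^+ n.
Proof.
move=> r0; pose N := (m.+1 * m.+1)%N.
rewrite (@riemann_sum_prod m (fun t => `|t| <= r%:R)
  (N - r * m.+1) (N + r * m.+1)) => [|j jN].
  (* Each coordinate has at most 2r(m+1) + 1 indices; the factor 3 absorbs the extra endpoint since
     r is positive. *)
  rewrite lerXn2r ?nnegrE// ler_pdivrMr// -natrM ler_nat.
  rewrite -/N; nia.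
rewrite normrM normfV normr_nat ler_pdivrMr// -natrM ler_norml.
rewrite -/N lerBrDl !lerBlDl -!natrD !ler_nat; lia.
Qed.

Lemma riemann_sum_cube m : 1 <= riemann_sum m (fun x => (cube x)%:R).
Proof.
pose N := (m.+1 * m.+1)%N.
rewrite (@riemann_sum_prod m (fun t => 0 <= t <= 1) N (N + m.+1)) => [|j jN].
  rewrite exprn_ege1// ler_pdivlMr// mul1r ler_nat -/N; nia.
rewrite pmulr_lge0 ?invr_gt0// ler_pdivrMr// mul1r subr_ge0 ler_nat.
by rewrite lerBlDl -natrD ler_nat.
Qed.

Lemma riemann_sumD m f g :
  riemann_sum m (fun x => f x + g x) = riemann_sum m f + riemann_sum m g.
Proof. by rewrite /riemann_sum big_split/= mulrDr. Qed.

Lemma riemann_sumZ m c f :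
  riemann_sum m (fun x => c * f x) = c * riemann_sum m f.
Proof. by rewrite /riemann_sum -mulr_sumr mulrCA. Qed.

Lemma riemann_sum_le m f g :
  (forall x, f x <= g x) -> riemann_sum m f <= riemann_sum m g.
Proof.
move=> fg; rewrite ler_wpM2l ?invr_ge0 ?exprn_ge0//.
by apply: ler_sum => k _; exact: fg.
Qed.

Lemma riemann_sum_norm m f :
  `|riemann_sum m f| <= riemann_sum m (fun x => `|f x|).
Proof.
rewrite normrM ger0_norm ?invr_ge0 ?exprn_ge0//.
by rewrite ler_wpM2l ?invr_ge0 ?exprn_ge0// ler_norm_sum.
Qed.

(** A translation by one mesh step permutes the indices cyclically, except for the value of [g] at
    the wrap-around, where both points lie outside its support. *)
Lemma riemann_sum_shift m r i g : (r < m.+1)%N ->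
  (forall x, ~~ box r x -> g x = 0) ->
  riemann_sum m (fun x => g (m.+1%:R^-1 *: basis_vec R i + x)) =
  riemann_sum m g.
Proof.
move=> rm g0; congr (_ * _).
pose sh (k : lattice_index m) : lattice_index m :=
  [ffun j => if j == i then ordS (k j) else k j].
pose sh' (k : lattice_index m) : lattice_index m :=
  [ffun j => if j == i then ord_pred (k j) else k j].
have shb : bijective sh.
  exists sh' => k; apply/ffunP => j; rewrite !ffunE; case: eqP => //.
    by rewrite ordSK.
  by rewrite ord_predK.
rewrite [RHS](reindex sh) /=; last exact: onW_bij.
apply: eq_bigr => k _.
have M0 : (m.+1%:R : R) != 0 by [].
have [kl|kl] := boolP ((k i).+1 < 2 * (m.+1 * m.+1))%N.
  congr (g _); apply/rowP => j; rewrite !mxE !ffunE eqxx/=.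
  case: eqP => [->|_]; last by rewrite mulr0 add0r.
  rewrite /= modn_small// -[(k i).+1]addn1 natrD; by field.
(* Here [k i] is the last index: the translated point has i-th coordinate m+1 and the wrapped one
   -(m+1), both larger than r in absolute value. *)
rewrite !g0//; rewrite negb_forall; apply/existsP; exists i.
  rewrite !mxE !ffunE eqxx/= -ltNge.
  have -> : ((k i).+1 = 2 * (m.+1 * m.+1))%N by have := ltn_ord (k i); lia.
  rewrite modnn sub0r mulNr normrN ger0_norm ?mulr_ge0//.
  by rewrite natrM mulfK// ltr_nat.
rewrite !mxE eqxx/= -ltNge mulr1.
have E : ((k i).+1 = 2 * (m.+1 * m.+1))%N by have := ltn_ord (k i); lia.
have -> : m.+1%:R^-1 + ((k i)%:R - (m.+1 * m.+1)%:R) / m.+1%:R =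
    m.+1%:R :> R.
  have -> : (k i)%:R = (k i).+1%:R - 1 :> R by rewrite -[(k i).+1]addn1 natrD addrK.
  rewrite E !natrM; by field.
by rewrite ger0_norm// ltr_nat.
Qed.

End lattice.

(** * Riemann sums of derivatives, and a functional that behaves like the integral *)

Lemma is_derive_line (R : realType) (V : normedModType R) (f : V -> R)
    (x v : V) (t d : R) :
  is_derive (t *: v + x) v f d -> is_derive t 1 (fun s => f (s *: v + x)) d.
Proof.
move=> [fv <-].
have E : (fun h : R => h^-1 *: (((fun s => f (s *: v + x)) \o shift t) (h *: 1)
      - f (t *: v + x))) =
    (fun h : R => h^-1 *: ((f \o shift (t *: v + x)) (h *: v) - f (t *: v + x))).
  by apply/funext => h /=; rewrite [h%:A]mulr1 scalerDl addrA.
by split; rewrite /derivable /derive E.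
Qed.

Lemma box_compact (R : realType) n r : compact [set x : 'rV[R]_n | box r x].
Proof.
rewrite (_ : mkset _ =
    [set x : 'rV[R]_n | forall i, `[- r%:R, r%:R]%classic (x ord0 i)]).
  by apply: (@rV_compact R n (fun=> `[- r%:R, r%:R]%classic)) => i;
    exact: segment_compact.
apply/seteqP; split=> x /= => [/forallP xr i|xr].
  by rewrite in_itv/= -ler_norml.
by apply/forallP => i; have := xr i; rewrite in_itv/= -ler_norml.
Qed.

(** Compactness of the box, in near-covering form, makes an estimate that is local in x uniform over
    the whole box. *)
Lemma box_unif_continuous (R : realType) n r (W : 'rV[R]_n -> R)
    (v : 'rV[R]_n) (e : R) :
  continuous W -> 0 < e ->
  exists2 d, 0 < d & forall x t, box r x -> `|t| < d ->
    `|W (t *: v + x) - W x| <= e.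
Proof.
move=> cW e0.
have /compact_near_coveringP cK := @box_compact R n r.
have [|d /= d0 dK] := cK R (nbhs (0 : R))
    (fun t x => `|W (t *: v + x) - W x| <= e) _ _; last first.
  exists d => // x t xr td; apply: (dK t) => //=.
  by rewrite sub0r normrN.
move=> x _.
have e20 : 0 < e / 2 by lra.
have Wx : \forall y \near x, `|W x - W y| < e / 2.
  by have /cvgrPdist_lt := cW x; apply.
have W2 : \forall z \near (x, 0 : R), `|W x - W (z.2 *: v + z.1)| < e / 2.
  have : (z.2 *: v + z.1) @[z --> (x, 0 : R)] --> x.
    rewrite -[X in _ --> X]add0r -(scale0r v).
    by apply: cvgD; [apply: cvgZr_tmp; exact: cvg_snd|exact: cvg_fst].
  by move/(_ _ Wx).
have W1 : \forall z \near (x, 0 : R), `|W x - W z.1| < e / 2.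
  exact: (@cvg_fst _ _ (nbhs x) (nbhs (0 : R)) _ _ Wx).
near=> z => /=.
have h1 : `|W x - W z.1| < e / 2 by near: z.
have h2 : `|W x - W (z.2 *: v + z.1)| < e / 2 by near: z.
rewrite -(subrK (W x) (W (z.2 *: v + z.1))) -addrA.
by apply: le_trans (ler_normD _ _) _; rewrite distrC; lra.
Unshelve. all: by end_near. Qed.

(** The difference quotient of [V] with step equal to the mesh has Riemann sum exactly 0 by
    translation invariance, and by the mean value theorem it is uniformly close to [W]. *)
Lemma riemann_sum_derive_cvg0 (R : realType) n r i (V W : 'rV[R]_n -> R) :
  (forall x, ~~ box r x -> V x = 0) -> (forall x, ~~ box r x -> W x = 0) ->
  (forall x, is_derive x (basis_vec R i) V (W x)) -> continuous W ->
  riemann_sum m W @[m --> \oo] --> (0 : R).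
Proof.
move=> V0 W0 VW cW; apply/cvgrPdist_le => /= e e0.
(* The box is enlarged by one unit because the step h is at most 1, so the translate of [V] vanishes
   off [box r.+1]. *)
pose K : R := (3 * r.+1)%:R ^+ n.
have K0 : 0 < K by rewrite exprn_gt0.
have eK0 : 0 < e / K by rewrite divr_gt0.
have [d d0 dW] := @box_unif_continuous R n r.+1 W (basis_vec R i) _ cW eK0.
near=> m.
have rm : (r < m.+1)%N by near: m; exists r.
have hd : m.+1%:R^-1 < d.
  by near: m; exact: (near_infty_natSinv_lt (PosNum d0)).
set h : R := m.+1%:R^-1 in hd *.
have h0 : 0 < h by rewrite invr_gt0.
have h1 : h <= 1 by rewrite invf_le1// ler1n.
rewrite sub0r normrN.
have -> : riemann_sum m W = riemann_sum m (fun x =>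
    W x + (- h^-1) * (V (h *: basis_vec R i + x) + (- 1) * V x)).
  rewrite riemann_sumD riemann_sumZ riemann_sumD riemann_sumZ.
  rewrite (@riemann_sum_shift _ _ _ r)//; ring.
apply: le_trans (riemann_sum_norm _ _) _.
apply: (@le_trans _ _ (riemann_sum m (fun x => e / K * (box r.+1 x)%:R))).
  apply: riemann_sum_le => x.
  have [xr|xr] := boolP (box r.+1 x); last first.
    have xr' : ~~ box r x by apply: contra xr; exact: box_le.
    have xhr : ~~ box r (h *: basis_vec R i + x).
      apply: contra xr => /forallP H; apply/forallP => j.
      have := H j; rewrite !mxE eqxx/= => Hj.
      have -> : x ord0 j = (h * (j == i)%:R + x ord0 j) - h * (j == i)%:R by ring.
      apply: le_trans (ler_normB _ _) _; rewrite -[r.+1]addn1 natrD lerD//.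
      by case: (j == i); rewrite ?mulr1 ?mulr0 ?normr0// ger0_norm// ltW.
    by rewrite !V0// W0// !(mulr0, addr0, normr0).
  rewrite mulr1.
  pose F (t : R) := V (t *: basis_vec R i + x).
  have dF (t : R) : is_derive t 1 F (W (t *: basis_vec R i + x)).
    exact: is_derive_line.
  have [|c] := @MVT _ F (fun t => W (t *: basis_vec R i + x)) 0 h h0.
  - apply: derivable_within_continuous => t _; exact: ex_derive.
  rewrite in_itv/= => /andP[c0 ch].
  rewrite /F scale0r add0r subr0 => E.
  have -> : W x + - h^-1 * (V (h *: basis_vec R i + x) + -1 * V x) =
     - (W (c *: basis_vec R i + x) - W x).
    rewrite mulN1r E; field; exact: lt0r_neq0.
  by rewrite normrN; apply: dW => //; rewrite ger0_norm; lra.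
rewrite riemann_sumZ; apply: (@le_trans _ _ (e / K * K)).
  by rewrite ler_wpM2l ?(ltW eK0)// riemann_sum_box.
by rewrite divfK// lt0r_neq0.
Unshelve. all: by end_near. Qed.

(** The substitute for Lebesgue integration on bounded functions of bounded support. The box and
    cube fields fix the scale from above and below; the last field yields integration by parts. *)
Record integral_like (R : realType) n (L : ('rV[R]_n -> R) -> R) : Prop := {
  integral_likeD : forall f g, bounded_support f -> bounded_support g ->
    L (fun x => f x + g x) = L f + L g;
  integral_likeZ : forall c f, bounded_support f ->
    L (fun x => c * f x) = c * L f;
  integral_like_ge0 : forall f, bounded_support f -> (forall x, 0 <= f x) ->
    0 <= L f;
  integral_like_box : forall r, (0 < r)%N ->
    L (fun x => (box r x)%:R) <= (3 * r)%:R ^+ n;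
  integral_like_cube : 1 <= L (fun x => (cube x)%:R);
  integral_like_derive : forall r i V W,
    (forall x, ~~ box r x -> V x = 0) -> (forall x, ~~ box r x -> W x = 0) ->
    (forall x, is_derive x (basis_vec R i) V (W x)) -> continuous W ->
    L W = 0 }.

Lemma bounded_support_box (R : realType) n r :
  bounded_support (fun x : 'rV[R]_n => (box r x)%:R).
Proof. by exists 1, r => x; rewrite mul1r ger0_norm. Qed.

Lemma bounded_support_cube (R : realType) n :
  bounded_support (fun x : 'rV[R]_n => (cube x)%:R).
Proof.
exists 1, 1%N => x; rewrite mul1r ger0_norm// ler_nat.
suff : cube x -> box 1 x by case: cube => // ->.
move=> /forallP xc; apply/forallP => i; have /andP[x0 x1] := xc i.
by rewrite ger0_norm.
Qed.

(** [L] is the limit of Riemann sums along an ultrafilter finer than [\oo]: it exists on every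
    bounded function of bounded support, and it agrees with ordinary limits. *)
Lemma integral_like_exists (R : realType) n :
  exists L : ('rV[R]_n -> R) -> R, integral_like L.
Proof.
have [U [UU ooU]] := ultraFilterLemma (@eventually_filter).
have cvgU (f : 'rV[R]_n -> R) : bounded_support f -> cvg (riemann_sum m f @[m --> U]).
  move=> [C [r fC]].
  apply: (@ultra_bounded_cvg _ _ _ (`|C| * (3 * r.+1)%:R ^+ n)) => m.
  apply: le_trans (riemann_sum_norm _ _) _.
  (* [r.+1] replaces [r], which may be 0, because the box estimate needs a positive radius. *)
  apply: (@le_trans _ _ (riemann_sum m (fun x => `|C| * (box r.+1 x)%:R))).
    apply: riemann_sum_le => x; apply: le_trans (fC x) _.
    apply: le_trans (ler_norm _) _; rewrite normrM ler_wpM2l// normr_nat ler_nat.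
    by case: (boolP (box r x)) => // /(box_le (leqnSn r)) ->.
  by rewrite riemann_sumZ; apply: ler_wpM2l => //; exact: riemann_sum_box.
exists (fun f => lim (riemann_sum m f @[m --> U])); split.
- move=> f g /cvgU cf /cvgU cg; apply/cvg_lim => //.
  by under eq_fun do rewrite riemann_sumD; exact: cvgD.
- move=> c f /cvgU cf; apply/cvg_lim => //.
  by under eq_fun do rewrite riemann_sumZ; exact: cvgMl_tmp.
- move=> f /cvgU cf f0; apply: limr_ge => //.
  by apply: nearW => m; rewrite mulr_ge0 ?invr_ge0 ?exprn_ge0 ?sumr_ge0.
- move=> r r0; apply: limr_le; first exact/cvgU/bounded_support_box.
  by apply: nearW => m; exact: riemann_sum_box.
- apply: limr_ge; first exact/cvgU/bounded_support_cube.
  by apply: nearW => m; exact: riemann_sum_cube.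
- move=> r i V W V0 W0 VW cW; apply/cvg_lim => //.
  apply: cvg_trans (riemann_sum_derive_cvg0 V0 W0 VW cW).
  by move=> A; exact: ooU.
Qed.

(** * Laplacians and truncated powers *)

Lemma Ck_continuous (R : realType) n k (f : 'rV[R]_n -> R) :
  Ck k f -> continuous f.
Proof. by case: k => // k []. Qed.

Lemma CkS (R : realType) n k (f : 'rV[R]_n -> R) : Ck k.+1 f -> Ck k f.
Proof.
elim: k f => [|k IH] f [cf Hf]; first exact: cf.
by split=> // i; have [df Cf] := Hf i; split => //; exact: IH.
Qed.

Lemma Ck0 (R : realType) n k : Ck k (fun _ : 'rV[R]_n => 0 : R).
Proof.
elim: k => [|k IH]; first by move=> x; exact: cst_continuous.
split=> [x|i]; first exact: cst_continuous.
split=> [x|]; first exact: derivable_cst.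
suff -> : partial i (fun=> 0) = (fun=> 0) :> ('rV[R]_n -> R) by [].
by apply/funext => x; exact: (derive_cst (0 : R)).
Qed.

Lemma CkD (R : realType) n k (f g : 'rV[R]_n -> R) :
  Ck k f -> Ck k g -> Ck k (fun x => f x + g x).
Proof.
elim: k f g => [|k IH] f g.
  by move=> cf cg x; exact: (continuousD (cf x) (cg x)).
move=> [cf Hf] [cg Hg]; split=> [x|i]; first exact: (continuousD (cf x) (cg x)).
have [[df Cf] [dg Cg]] := (Hf i, Hg i).
split=> [x|]; first exact: derivableD.
rewrite (_ : partial _ _ = fun x => partial i f x + partial i g x).
  exact: IH.
by apply/funext => x; exact: deriveD.
Qed.

Lemma Ck_laplacian (R : realType) n k (f : 'rV[R]_n -> R) :
  Ck k.+2 f -> Ck k (laplacian f).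
Proof.
move=> [_ Hf]; rewrite /laplacian.
elim: (index_enum _) => [|i r IH].
  by under eq_fun do rewrite big_nil; exact: Ck0.
under eq_fun do rewrite big_cons.
by apply: CkD => //; have [_ [_ /(_ i)[]]] := Hf i.
Qed.

Definition sqnorm (R : realType) n (x : 'rV[R]_n) : R :=
  \sum_(i < n) x ord0 i ^+ 2.

(** The truncated power (t_+)^k; for k = 0 it is the constant 1, also at negative t, so vanishing is
    only claimed for positive exponents. *)
Definition pospow (R : realType) (k : nat) (t : R) : R := Num.max 0 t ^+ k.

Section pospow.
Context {R : realType}.
Implicit Types (k : nat) (t a d : R).

Lemma pospow_ge0 k t : 0 <= pospow k t.
Proof. by rewrite exprn_ge0// le_max lexx. Qed.

Lemma pospow_le0 k t : t <= 0 -> pospow k.+1 t = 0.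
Proof. by move=> t0; rewrite /pospow max_l// expr0n. Qed.

Lemma pospow_ge0E k t : 0 <= t -> pospow k t = t ^+ k.
Proof. by move=> t0; rewrite /pospow max_r. Qed.

Lemma pospow_continuous k : continuous (@pospow R k).
Proof.
move=> t; apply: (@continuous_comp _ _ _ (fun t : R => Num.max 0 t)
  (fun s => s ^+ k)); last exact: exprn_continuous.
by apply: continuous_max => //; exact: cvg_cst.
Qed.

(** Without truncation the remainder is d^2 for k = 1 and 3ad^2 + d^3 for k = 2, and the bound
    covers both. If a and a + d have opposite signs, both are at most |d| in absolute value. *)
Lemma pospow_taylor k a d : (0 < k < 3)%N ->
  `|pospow k.+1 (a + d) - pospow k.+1 a - k.+1%:R * d * pospow k a| <=
  (3 * `|a| + `|d| + 1) * d ^+ 2.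
Proof.
move=> k3.
have [a1 a2] := (ler_norm a, ler_norm (- a)); rewrite normrN in a2.
have [d1 d2] := (ler_norm d, ler_norm (- d)); rewrite normrN in d2.
have dd0 : 0 <= d ^+ 2 by exact: sqr_ge0.
have ad1 := ler_wpM2r dd0 a1; have ad2 := ler_wpM2r dd0 a2.
have dd1 := ler_wpM2r dd0 d1; have dd2 := ler_wpM2r dd0 d2.
have ad0 := mulr_ge0 (normr_ge0 a) dd0; have dd00 := mulr_ge0 (normr_ge0 d) dd0.
rewrite 2!mulrDl mul1r -[3 * `|a| * _]mulrA; move: ad1 ad2 dd1 dd2 ad0 dd00.
(* Naming these products leaves goals linear in the monomials, within reach of [lra]. *)
move: (`|a| * d ^+ 2) (`|d| * d ^+ 2) => u v ad1 ad2 dd1 dd2 u0 v0.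
rewrite ler_norml /pospow.
case: k k3 => [|[|[|//]]]// _;
  have [h1|h1] := leP 0 (a + d); have [h2|h2] := leP 0 a; apply/andP.
- by split; lra.
- have : (a + d) ^+ 2 <= d ^+ 2 by rewrite lerXn2r ?nnegrE; lra.
  have : 0 <= (a + d) ^+ 2 by exact: sqr_ge0.
  by split; lra.
- have : 0 <= (a + d) ^+ 2 by exact: sqr_ge0.
  have : 0 <= a * (- (a + d)) by rewrite mulr_ge0//; lra.
  have : 0 <= a * (- d) by rewrite mulr_ge0//; lra.
  by split; lra.
- by split; lra.
- by split; lra.
- have : (a + d) ^+ 3 <= d ^+ 3 by rewrite lerXn2r ?nnegrE; lra.
  have : 0 <= (a + d) ^+ 3 by rewrite exprn_ge0.
  by split; lra.
- have : 0 <= a ^+ 2 * (- (a + d)) by rewrite mulr_ge0 ?sqr_ge0//; lra.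
  have : 0 <= a ^+ 2 * (- d) by rewrite mulr_ge0 ?sqr_ge0//; lra.
  have : 0 <= a * (- d) * (- (a + d)) by rewrite !mulr_ge0//; lra.
  have : 0 <= a ^+ 3 by rewrite exprn_ge0.
  by split; lra.
- by split; lra.
Qed.

End pospow.

(** Dividing by t leaves an error of at most C|t|. Differentiation, including that of [moment] in s,
    is thereby reduced to a quadratic remainder bound, with no exchange of limits. *)
Lemma is_derive_quadratic (R : realType) (V : normedModType R) (f : V -> R)
    (x v : V) (d C : R) :
  (forall t, `|t| <= 1 -> `|f (t *: v + x) - f x - t * d| <= C * t ^+ 2) ->
  is_derive x v f d.
Proof.
move=> fC.
have C0 : 0 <= C.
  by have := fC 1; rewrite normr1 expr1n mulr1 => /(_ (lexx _)); exact: le_trans.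
have cvgd : h^-1 *: ((f \o shift x) (h *: v) - f x) @[h --> 0^'] --> d.
  apply/cvgrPdist_le => /= e e0; near=> h.
  have h0 : h != 0 by near: h; exact: nbhs_dnbhs_neq.
  have hn0 : 0 < `|h| by rewrite normr_gt0.
  have h1 : `|h| <= 1.
    by near: h; apply: dnbhs0_le.
  have hC : `|h| <= e / (C + 1).
    by near: h; apply: dnbhs0_le; rewrite divr_gt0//; lra.
  have -> : d - h^-1 *: (f (h *: v + x) - f x) =
      - (h^-1 * (f (h *: v + x) - f x - h * d)).
    by rewrite /GRing.scale/=; field.
  rewrite normrN normrM normfV mulrC ler_pdivrMr//.
  apply: le_trans (fC _ h1) _;
  rewrite -(real_normK (num_real h)) expr2 mulrA ler_pM2r//.
  move: hC; rewrite ler_pdivlMr; last lra.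
  by rewrite mulrDr mulr1 mulrC; lra.
by split; [apply/cvg_ex; exists d|exact/cvg_lim].
Unshelve. all: by end_near. Qed.

(** * Moments against truncated powers of s - |x|^2 *)

Section weighted.
Context {R : realType} {n : nat}.
Implicit Types (g h : 'rV[R]_n -> R) (s : R) (k r : nat).

Lemma continuous_funM g h :
  continuous g -> continuous h -> continuous (fun x => g x * h x).
Proof. by move=> cg ch x; exact: (continuousM (cg x) (ch x)). Qed.

Lemma continuous_funD g h :
  continuous g -> continuous h -> continuous (fun x => g x + h x).
Proof. by move=> cg ch x; exact: (continuousD (cg x) (ch x)). Qed.

Lemma continuous_funC (c : R) : continuous (fun _ : 'rV[R]_n => c).
Proof. by move=> x; exact: cst_continuous. Qed.

Lemma sqnorm_continuous : continuous (@sqnorm R n).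
Proof.
rewrite /sqnorm; elim: (index_enum _) => [|i l IH].
  by under eq_fun do rewrite big_nil; exact: continuous_funC.
under eq_fun do rewrite big_cons expr2.
by apply: continuous_funD => //; apply: continuous_funM; exact: coord_continuous.
Qed.

Lemma pospow_sqnorm_continuous k s :
  continuous (fun x : 'rV[R]_n => pospow k (s - sqnorm x)).
Proof.
move=> x; apply: (@continuous_comp _ _ _ (fun x : 'rV[R]_n => s - sqnorm x)
  (@pospow R k)); last exact: pospow_continuous.
by apply: continuousB; [exact: cst_continuous|exact: sqnorm_continuous].
Qed.

Lemma box_bounded r g : continuous g ->
  exists2 C, 0 <= C & forall x, box r x -> `|g x| <= C.
Proof.
move=> cg.
have K0 : [set x : 'rV[R]_n | box r x] !=set0.
  by exists 0 => /=; apply/forallP => i; rewrite mxE normr0.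
have cn : continuous (fun x => `|g x|).
  move=> x; apply: (@continuous_comp _ _ _ g (fun y => `|y|)); first exact: cg.
  exact: norm_continuous.
have [|c _ cmax] := @EVT_max_rV R n (fun x => `|g x|) _ K0 (@box_compact R n r).
  exact: continuous_subspaceT.
by exists `|g c| => // x xr; apply: cmax; rewrite inE.
Qed.

Lemma bounded_support_continuous r g : continuous g ->
  (forall x, ~~ box r x -> g x = 0) -> bounded_support g.
Proof.
move=> /(@box_bounded r)[C C0 gC] g0; exists C, r => x.
have [xr|/g0->] := boolP (box r x); first by rewrite mulr1 gC.
by rewrite normr0 mulr0.
Qed.

Lemma sqr_coord_le (x : 'rV[R]_n) i : x ord0 i ^+ 2 <= sqnorm x.
Proof.
by rewrite /sqnorm (bigD1 i)//= lerDl sumr_ge0// => j _; exact: sqr_ge0.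
Qed.

Lemma sqnorm_ge0 (x : 'rV[R]_n) : 0 <= sqnorm x.
Proof. by apply: sumr_ge0 => j _; exact: sqr_ge0. Qed.

Lemma sqnorm_le_box r (x : 'rV[R]_n) : sqnorm x <= r%:R ^+ 2 -> box r x.
Proof.
move=> xr; apply/forallP => i.
rewrite -(@ler_pXn2r _ 2) ?nnegrE// real_normK ?num_real//.
exact: le_trans (sqr_coord_le x i) xr.
Qed.

Lemma pospow_support k s r (x : 'rV[R]_n) : s <= r%:R ^+ 2 -> ~~ box r x ->
  pospow k.+1 (s - sqnorm x) = 0.
Proof.
move=> sr xr; apply: pospow_le0; rewrite subr_le0; apply: le_trans sr _.
by rewrite leNgt; apply: contra xr => /ltW; exact: sqnorm_le_box.
Qed.

Lemma natsqr_ge s : exists r, s <= r%:R ^+ 2.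
Proof.
exists (Num.truncn `|s|).+1.
apply: le_trans (ler_norm _) _; apply: le_trans (ltW (truncnS_gt _)) _.
by rewrite -natrX ler_nat expnS expn1 leq_pmulr.
Qed.

Lemma bounded_support_pospow k s g : continuous g ->
  bounded_support (fun x => g x * pospow k.+1 (s - sqnorm x)).
Proof.
move=> cg; have [r sr] := natsqr_ge s.
apply: (@bounded_support_continuous r).
  by apply: continuous_funM => //; exact: pospow_sqnorm_continuous.
by move=> x xr; rewrite (pospow_support _ sr)// mulr0.
Qed.

Lemma bounded_supportD g h : bounded_support g -> bounded_support h ->
  bounded_support (fun x => g x + h x).
Proof.
have wid (C : R) r r' (x : 'rV[R]_n) :
    C * (box r x)%:R <= `|C| * (box (maxn r r') x)%:R.
  apply: le_trans (ler_norm _) _; rewrite normrM normr_nat ler_wpM2l// ler_nat.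
  by case: (boolP (box r x)) => // /(box_le (leq_maxl r r')) ->.
move=> [C [r gC]] [C' [r' hC]]; exists (`|C| + `|C'|), (maxn r r') => x.
apply: le_trans (ler_normD _ _) _; rewrite mulrDl lerD//.
  exact: le_trans (gC x) (wid _ _ _ _).
by rewrite maxnC; exact: le_trans (hC x) (wid _ _ _ _).
Qed.

Lemma bounded_supportZ (c : R) g : bounded_support g ->
  bounded_support (fun x => c * g x).
Proof.
move=> [C [r gC]]; exists (`|c| * C), r => x.
by rewrite normrM -mulrA ler_wpM2l.
Qed.

Lemma bounded_support_sum (I : Type) (l : seq I) (F : I -> 'rV[R]_n -> R) :
  (forall i, bounded_support (F i)) ->
  bounded_support (fun x => \sum_(i <- l) F i x).
Proof.
move=> bF; elim: l => [|i l IH].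
  under eq_fun do rewrite big_nil.
  by exists 0, 0%N => x; rewrite normr0 mul0r.
by under eq_fun do rewrite big_cons; exact: bounded_supportD.
Qed.

Context (L : ('rV[R]_n -> R) -> R) (IL : integral_like L).

Lemma integral_like_le g h : bounded_support g -> bounded_support h ->
  (forall x, g x <= h x) -> L g <= L h.
Proof.
move=> bg bh gh; rewrite -subr_ge0.
have bg' := bounded_supportZ (-1) bg.
have -> : L h - L g = L (fun x => h x + -1 * g x).
  by rewrite (integral_likeD IL)// (integral_likeZ IL)// mulN1r.
apply: (integral_like_ge0 IL); first exact: bounded_supportD.
by move=> x; rewrite mulN1r subr_ge0.
Qed.

Lemma integral_like_norm g C r :
  (forall x, `|g x| <= C * (box r x)%:R) ->
  `|L g| <= C * L (fun x => (box r x)%:R).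
Proof.
move=> gC; have bg : bounded_support g by exists C, r.
have bb := @bounded_support_box R n r.
rewrite ler_norml -mulNr -!(integral_likeZ IL)//; apply/andP; split;
  apply: integral_like_le => //; try exact: bounded_supportZ;
  by move=> x; have := gC x; rewrite ler_norml ?mulNr => /andP[].
Qed.

Lemma integral_like_sum (I : Type) (l : seq I) (F : I -> 'rV[R]_n -> R) :
  (forall i, bounded_support (F i)) ->
  L (fun x => \sum_(i <- l) F i x) = \sum_(i <- l) L (F i).
Proof.
move=> bF; elim: l => [|i l IH].
  rewrite big_nil.
  (* Writing the zero function as 0 times an indicator lets homogeneity give it the value 0. *)
  have -> : (fun x : 'rV[R]_n => \sum_(i <- [::]) F i x) =
      (fun x => 0 * (box 0 x)%:R).
    by apply/funext => x; rewrite big_nil mul0r.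
  by rewrite (integral_likeZ IL) ?mul0r//; exact: bounded_support_box.
rewrite big_cons -IH -(integral_likeD IL)//; last exact: bounded_support_sum.
by congr L; apply/funext => x; rewrite big_cons.
Qed.

(** For k = 3 and g the j-th iterated Laplacian of u, this is A_j, with [L] in place of the
    integral. *)
Definition moment k g s := L (fun x => g x * pospow k (s - sqnorm x)).

Lemma moment_derive k g s : (0 < k < 3)%N -> continuous g ->
  is_derive s 1 (moment k.+1 g) (k.+1%:R * moment k g s).
Proof.
(* The radius is chosen for s + 1 so that one box contains the supports for all parameters t + s
   with |t| at most 1. *)
move=> k3 cg; have [r sr] := natsqr_ge (s + 1).
have sr' : s <= r%:R ^+ 2 by lra.
(* This dominates |g| times the constant 3|a| + |t| + 1 of [pospow_taylor] when |t| is at most 1. *)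
pose G x := `|g x| * (3 * `|s - sqnorm x| + 2).
have cG : continuous G.
  apply: continuous_funM.
    by move=> x; apply: (@continuous_comp _ _ _ g (fun y => `|y|));
      [exact: cg|exact: norm_continuous].
  apply: continuous_funD; last exact: continuous_funC.
  apply: continuous_funM; first exact: continuous_funC.
  move=> x; apply: (@continuous_comp _ _ _ (fun x : 'rV[R]_n => s - sqnorm x)
    (fun y => `|y|)); last exact: norm_continuous.
  by apply: continuousB; [exact: cst_continuous|exact: sqnorm_continuous].
have [C C0 GC] := box_bounded r cG.
apply: (@is_derive_quadratic _ _ _ _ _ _ (C * L (fun x => (box r x)%:R))) => t t1.
rewrite [t *: 1]mulr1.
have bk j u : (0 < j)%N ->
    bounded_support (fun x => g x * pospow j (u - sqnorm x)).
  by case: j => // j _; exact: bounded_support_pospow.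
have k0 : (0 < k)%N by case/andP: k3.
have -> : moment k.+1 g (t + s) - moment k.+1 g s - t * (k.+1%:R * moment k g s)
  = L (fun x => g x * pospow k.+1 (t + s - sqnorm x) +
     (- 1 * (g x * pospow k.+1 (s - sqnorm x)) +
     (- (t * k.+1%:R)) * (g x * pospow k (s - sqnorm x)))).
  have b1 := bounded_supportZ (-1) (bk k.+1 s isT).
  have b2 := bounded_supportZ (- (t * k.+1%:R)) (bk k s k0).
  rewrite (integral_likeD IL) ?(integral_likeD IL) ?(integral_likeZ IL)//.
  - by rewrite /moment; ring.
  - exact: bk.
  - exact: bk.
  - exact: bk.
  - exact: bounded_supportD.
rewrite mulrAC; apply: integral_like_norm => x.
have [xr|xr] := boolP (box r x); last first.
  have tsr : t + s <= r%:R ^+ 2 by have := ler_norm t; lra.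
  rewrite !(pospow_support _ _ xr)// -(prednK k0) (pospow_support _ _ xr)//.
  by rewrite !(mulr0, addr0) normr0.
rewrite mulr1.
have -> : t + s - sqnorm x = (s - sqnorm x) + t by ring.
have Ga := GC x xr; rewrite /G in Ga; move: (s - sqnorm x) Ga => a Ga.
have -> : g x * pospow k.+1 (a + t) + (- 1 * (g x * pospow k.+1 a) +
    (- (t * k.+1%:R)) * (g x * pospow k a)) =
    g x * (pospow k.+1 (a + t) - pospow k.+1 a - k.+1%:R * t * pospow k a).
  by ring.
rewrite normrM.
apply: le_trans (ler_wpM2l (normr_ge0 _) (pospow_taylor _ _ k3)) _.
rewrite mulrA ler_wpM2r ?sqr_ge0//.
move: Ga; rewrite ger0_norm; last by rewrite mulr_ge0// addr_ge0// mulr_ge0.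
by apply: le_trans; rewrite ler_wpM2l//; lra.
Qed.

End weighted.

(** * Green's identity *)

Lemma is_derive_coord (R : realType) n (x : 'rV[R]_n) i :
  is_derive x (basis_vec R i) (fun y : 'rV[R]_n => y ord0 i) 1.
Proof.
apply: (@is_derive_quadratic _ _ _ _ _ _ 0) => t _.
by rewrite !mxE !eqxx mulr1 addrK subrr normr0 mul0r.
Qed.

Lemma sqnorm_shift (R : realType) n (x : 'rV[R]_n) i (t : R) :
  sqnorm (t *: basis_vec R i + x) = sqnorm x + (2 * t * x ord0 i + t ^+ 2).
Proof.
rewrite /sqnorm (bigD1 i)//= [in RHS](bigD1 i)//= !mxE !eqxx mulr1.
rewrite [in LHS](eq_bigr (fun j => x ord0 j ^+ 2)) => [|j ji]; last first.
  by rewrite !mxE eqxx (negbTE ji) mulr0 add0r.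
ring.
Qed.

Lemma is_derive_pospow_sqnorm (R : realType) n k (s : R) (x : 'rV[R]_n) i :
  (0 < k < 3)%N ->
  is_derive x (basis_vec R i) (fun y : 'rV[R]_n => pospow k.+1 (s - sqnorm y))
    (- (2 * k.+1%:R) * x ord0 i * pospow k (s - sqnorm x)).
Proof.
(* Moving by t along the i-th axis changes s - |x|^2 by d with |d| <= D|t| for |t| <= 1. The Taylor
   remainder gives the first part of the constant, the t^2 inside d the second. *)
move=> k3; set a := s - sqnorm x; pose D := 2 * `|x ord0 i| + 1.
apply: (@is_derive_quadratic _ _ _ _ _ _
  ((3 * `|a| + D + 1) * D ^+ 2 + k.+1%:R * pospow k a)) => t t1.
rewrite sqnorm_shift.
pose d := - (2 * t * x ord0 i + t ^+ 2).
have -> : s - (sqnorm x + (2 * t * x ord0 i + t ^+ 2)) = a + d.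
  by rewrite /a /d; ring.
have -> : pospow k.+1 (a + d) - pospow k.+1 a
    - t * (- (2 * k.+1%:R) * x ord0 i * pospow k a) =
  (pospow k.+1 (a + d) - pospow k.+1 a - k.+1%:R * d * pospow k a) +
  (- (k.+1%:R * pospow k a * t ^+ 2)).
  by rewrite /d; ring.
have D0 : 0 <= D by rewrite addr_ge0// mulr_ge0.
have dD : `|d| <= D * `|t|.
  rewrite normrN; apply: le_trans (ler_normD _ _) _.
  rewrite expr2 !normrM normr_nat /D.
  have := ler_wpM2r (normr_ge0 t) t1; lra.
have dD1 : `|d| <= D by apply: le_trans dD _; rewrite ler_piMr.
have d2 : d ^+ 2 <= D ^+ 2 * t ^+ 2.
  rewrite -(real_normK (num_real d)) -(real_normK (num_real t)) -exprMn.
  by rewrite lerXn2r ?nnegrE// mulr_ge0.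
have pk0 := pospow_ge0 k a.
apply: le_trans (ler_normD _ _) _; rewrite mulrDl lerD//.
  apply: le_trans (pospow_taylor _ _ k3) _; rewrite -mulrA.
  apply: ler_pM.
  - by rewrite !addr_ge0// mulr_ge0.
  - exact: sqr_ge0.
  - by lra.
  - exact: d2.
by rewrite normrN ger0_norm ?lexx// mulr_ge0 ?sqr_ge0 ?mulr_ge0.
Qed.

Lemma partial_is_derive (R : realType) n i (g : 'rV[R]_n -> R) x :
  derivable g x (basis_vec R i) -> is_derive x (basis_vec R i) g (partial i g x).
Proof. by move=> dg; split. Qed.

(* Green's second identity against [w = (s - |x|^2)_+^3], for which
   [lap w = 24 s (s - |x|^2)_+ - 48 (s - |x|^2)_+^2] in dimension 4. *)
Lemma moment_laplacian (R : realType) (L : ('rV[R]_4 -> R) -> R)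
    (g : 'rV[R]_4 -> R) (s : R) :
  integral_like L -> Ck 2 g ->
  moment L 3 (laplacian g) s = 24 * s * moment L 1 g s - 48 * moment L 2 g s.
Proof.
move=> IL C2g; have cg := Ck_continuous C2g; case: C2g => _ Hg.
pose P k (x : 'rV[R]_4) := pospow k (s - sqnorm x).
have cP k : continuous (P k) by exact: pospow_sqnorm_continuous.
have [r sr] := natsqr_ge s.
have P0 k x : ~~ box r x -> P k.+1 x = 0 by exact: pospow_support.
(* [W i] is the i-th partial derivative of w d_i g - g d_i w, where w = [P 3] and d_i w = -6 x_i
   [P 2]; the products of first derivatives cancel. *)
pose W (i : 'I_4) (x : 'rV[R]_4) := partial i (partial i g) x * P 3%N x
  + g x * (6 * P 2%N x + -24 * (x ord0 i * x ord0 i * P 1%N x)).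
have W0 i x : ~~ box r x -> W i x = 0.
  by move=> xr; rewrite /W !P0// !(mulr0, addr0).
have cW i : continuous (W i).
  have [_ [_ /(_ i)[_ cg2]]] := Hg i.
  have cx : continuous (fun x : 'rV[R]_4 => x ord0 i) by exact: coord_continuous.
  apply: continuous_funD (continuous_funM cg2 (cP 3%N)) _.
  apply: (continuous_funM cg); apply: continuous_funD.
    by apply: continuous_funM (cP 2%N); exact: continuous_funC.
  apply: continuous_funM; first exact: continuous_funC.
  exact: continuous_funM (continuous_funM cx cx) (cP 1%N).
have LW i : L (W i) = 0.
  have [dg [cdg /(_ i)[ddg _]]] := Hg i.
  pose V := P 3%N * partial i g
    - g * (cst (-6) * ((fun x : 'rV[R]_4 => x ord0 i) * P 2%N)).
  apply: (@integral_like_derive _ _ _ IL r i V (W i) _ (@W0 i) _ (cW i)) => [x xr|x].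
    rewrite (_ : V x = P 3%N x * partial i g x
      - g x * (-6 * (x ord0 i * P 2%N x)))//.
    by rewrite !P0// !(mul0r, mulr0, subr0).
  have d1 := partial_is_derive (dg x).
  have d2 := partial_is_derive (ddg x).
  have d3 := is_derive_coord x i.
  have d4 := @is_derive_pospow_sqnorm R 4 2 s x i isT.
  have d5 := @is_derive_pospow_sqnorm R 4 1 s x i isT.
  rewrite -/(P 3%N) -/(P 2%N) in d4 d5.
  have := is_deriveB (is_deriveM d4 d2) (is_deriveM d1
    (is_deriveM (is_derive_cst (-6 : R) x _) (is_deriveM d3 d5))) => H.
  apply: (is_derive_eq H); rewrite /W /P !fctE /GRing.scale/=.
  ring.
have bW i : bounded_support (W i).
  exact: bounded_support_continuous (cW i) (@W0 i).
have LS : L (fun x => \sum_(i < 4) W i x) = 0.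
  by rewrite (integral_like_sum IL)// big1.
have cl : continuous (laplacian g).
  have : Ck 2 g by split.
  by move=> /Ck_laplacian.
have b3 : bounded_support (fun x => laplacian g x * P 3%N x).
  exact: bounded_support_pospow.
have b2 : bounded_support (fun x => g x * P 2%N x).
  exact: bounded_support_pospow.
have b1 : bounded_support (fun x => g x * P 1%N x).
  exact: bounded_support_pospow.
have : L (fun x => laplacian g x * P 3%N x + (48 * (g x * P 2%N x) +
    (- (24 * s)) * (g x * P 1%N x))) = 0.
  rewrite -LS; congr L; apply/funext => x; rewrite /W.
  (* This identity eliminates |x|^2. The dimension enters through the sum over i, where 6 [P 2] is
     counted four times. *)
  have tP : (s - sqnorm x) * P 1%N x = P 2%N x.
    rewrite /P /pospow; have [h|h] := leP 0 (s - sqnorm x).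
      by rewrite expr1 expr2.
    by rewrite !expr0n/= mulr0.
  have -> (a b c : R) : \sum_(i < 4) (partial i (partial i g) x * a
      + g x * (6 * b + -24 * (x ord0 i * x ord0 i * c)))
    = laplacian g x * a + g x * (24 * b - 24 * (sqnorm x * c)).
    rewrite big_split/= -mulr_suml -mulr_sumr big_split/= sumr_const card_ord.
    rewrite -mulr_sumr -mulr_suml -mulr_natr -/(laplacian g x).
    rewrite -[\sum_(i < 4) x ord0 i * x ord0 i]/(sqnorm x).
    by congr (_ + _ * _); ring.
  have -> : sqnorm x * P 1%N x = s * P 1%N x - P 2%N x by rewrite -tP; ring.
  ring.
have bz2 := bounded_supportZ 48 b2; have bz1 := bounded_supportZ (- (24 * s)) b1.
rewrite (integral_likeD IL)//; last exact: bounded_supportD.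
rewrite (integral_likeD IL)// !(integral_likeZ IL)//.
rewrite /moment -/(P 3%N) => E; apply/eqP; rewrite -subr_eq0 -{}E; apply/eqP.
rewrite /P; ring.
Qed.

(** * Growth of the moments: upper bound from the decay hypothesis, lower bound from positivity *)

Lemma moment_growth (R : realType) (L : ('rV[R]_4 -> R) -> R)
    (u : 'rV[R]_4 -> R) :
  integral_like L -> continuous u ->
  (forall eps : R, 0 < eps -> exists M : R, forall x,
     M < enorm x -> `|u x| <= eps * enorm x ^+ 4) ->
  ~ grows (moment L 3 u) 7.
Proof.
move=> IL cu uo [k [s0 [k0 s00 kA]]].
(* 162 is twice the 81 = 3^4 coming from the size of boxes, so the leading term of the upper bound
   is k/2 s^7. *)
have e0 : 0 < k / 162 by lra.
have [M uM] := uo _ e0.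
pose r0 := (Num.truncn `|M|).+1.
have Mr0 : M < r0%:R by apply: le_lt_trans (ler_norm _) _; exact: truncnS_gt.
have [C C0 uC] := box_bounded r0 cu.
have enorm2 x : enorm x ^+ 2 = sqnorm x by rewrite sqr_sqrtr// sqnorm_ge0.
have ub x : `|u x| <= C + k / 162 * sqnorm x ^+ 2.
  have sq0 : 0 <= k / 162 * sqnorm x ^+ 2 by rewrite mulr_ge0 ?sqr_ge0//; lra.
  have [xM|xM] := ltP M (enorm x).
    apply: le_trans (uM _ xM) _.
    by rewrite (exprM _ 2 2) enorm2 lerDr.
  have : `|u x| <= C; last by lra.
  apply/uC/sqnorm_le_box; rewrite -enorm2 lerXn2r ?nnegrE ?sqrtr_ge0//.
  exact: le_trans xM (ltW Mr0).
(* At s = r^2 the weight is supported in [box r], of size at most (3r)^4 = 81 s^2, and is at most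
   s^3 there, while |x|^2 <= s bounds |u|. *)
have upper r (s : R) : (0 < r)%N -> s = r%:R ^+ 2 ->
    moment L 3 u s <= (C + k / 162 * s ^+ 2) * s ^+ 3 * (81 * s ^+ 2).
  move=> r1 sE.
  have s1 : 0 <= s by rewrite sE sqr_ge0.
  have K0 : 0 <= C + k / 162 * s ^+ 2.
    by rewrite addr_ge0// mulr_ge0 ?sqr_ge0//; lra.
  have K1 : 0 <= (C + k / 162 * s ^+ 2) * s ^+ 3.
    by rewrite mulr_ge0// exprn_ge0.
  apply: le_trans (ler_norm _) _.
  apply: le_trans (_ : _ <= (C + k / 162 * s ^+ 2) * s ^+ 3 *
    L (fun x => (box r x)%:R)) _.
    apply: (integral_like_norm IL) => x.
    have [xr|xr] := boolP (box r x); last first.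
      by rewrite (pospow_support _ _ xr) ?sE// !mulr0 normr0.
    rewrite mulr1 normrM; have [xs|xs] := leP (s - sqnorm x) 0.
      by rewrite pospow_le0// normr0 mulr0.
    have sx := sqnorm_ge0 x.
    rewrite pospow_ge0E ?(ltW xs)//.
    rewrite [X in _ * X <= _]ger0_norm ?exprn_ge0 ?(ltW xs)//.
    apply: ler_pM.
    - exact: normr_ge0.
    - by rewrite exprn_ge0// ltW.
    - apply: le_trans (ub x) _; rewrite lerD2l ler_wpM2l ?(ltW e0)//.
      by rewrite lerXn2r ?nnegrE//; lra.
    - by rewrite lerXn2r ?nnegrE//; lra.
  rewrite ler_wpM2l//; apply: le_trans (integral_like_box IL r1) _.
  by rewrite sE natrM le_eqVlt; apply/orP; left; apply/eqP; ring.
(* This makes s = r^2 exceed both s0 and 162 C / k, so that 81 C falls below k/2 s^2. *)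
pose r := (Num.truncn (s0 + 162 * C / k)).+1.
have r1 : (0 < r)%N by [].
have rb : s0 + 162 * C / k < r%:R by exact: truncnS_gt.
have Ck0 : 0 <= 162 * C / k by rewrite divr_ge0 ?mulr_ge0//; lra.
pose s : R := r%:R ^+ 2.
have rge1 : 1 <= r%:R :> R by rewrite ler1n.
have rs : r%:R <= s by rewrite ler_eXnr.
have s0s : s0 <= s by lra.
have := le_trans (kA s s0s) (upper r s r1 erefl).
have s5 : 0 < s ^+ 5 by rewrite exprn_gt0//; lra.
have -> : k * s ^+ 7 = k * s ^+ 2 * s ^+ 5 by ring.
have -> : (C + k / 162 * s ^+ 2) * s ^+ 3 * (81 * s ^+ 2) =
  (81 * C + k / 2 * s ^+ 2) * s ^+ 5 by field.
rewrite ler_pM2r// => H.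
have s2 : s <= s ^+ 2 by rewrite ler_eXnr//; lra.
have : 162 * C < k * s by rewrite -ltr_pdivrMl// mulrC; lra.
have : k * s <= k * s ^+ 2 by rewrite ler_pM2l.
lra.
Qed.

Lemma moment_positive_grows (R : realType) (L : ('rV[R]_4 -> R) -> R)
    (f : 'rV[R]_4 -> R) :
  integral_like L -> continuous f -> (forall x, 0 < f x) ->
  grows (moment L 3 f) 3.
Proof.
move=> IL cf f0.
have K0 : [set x : 'rV[R]_4 | box 1 x] !=set0.
  by exists 0 => /=; apply/forallP => i; rewrite mxE normr0.
have [|c _ cmin] := @EVT_min_rV R 4 f _ K0 (@box_compact R 4 1).
  exact: continuous_subspaceT.
(* On the unit cube |x|^2 <= 4, so s >= 8 gives s - |x|^2 >= s/2 and a weight of at least s^3 /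
   8. *)
exists (f c / 8), 8; split => //; first by rewrite divr_gt0.
move=> s s8.
have c0 : 0 <= f c / 8 * s ^+ 3.
  by rewrite mulr_ge0 ?exprn_ge0 ?divr_ge0 ?(ltW (f0 _))//; lra.
have bc := @bounded_support_cube R 4.
apply: le_trans (_ : _ <= f c / 8 * s ^+ 3 * L (fun x => (cube x)%:R)) _.
  by rewrite ler_peMr// (integral_like_cube IL).
rewrite -(integral_likeZ IL)//; apply: (integral_like_le IL).
- exact: bounded_supportZ.
- exact: bounded_support_pospow.
move=> x; have [xc|xc] := boolP (cube x); last first.
  by rewrite mulr0 mulr_ge0 ?pospow_ge0// ltW.
have x4 : sqnorm x <= 4.
  rewrite /sqnorm; apply: le_trans (_ : _ <= \sum_(i < 4) 1) _.
    apply: ler_sum => i _; move/forallP: xc => /(_ i)/andP[x0 x1].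
    by rewrite expr_le1.
  by rewrite sumr_const card_ord.
rewrite mulr1 -mulrA; apply: ler_pM => //.
- exact: ltW.
- by rewrite mulr_ge0// exprn_ge0//; lra.
- apply: cmin; rewrite inE/=; apply/forallP => i.
  by move/forallP: xc => /(_ i)/andP[x0 x1]; rewrite ger0_norm.
- rewrite pospow_ge0E; last lra.
  have -> : 8^-1 * s ^+ 3 = (s / 2) ^+ 3 by field.
  by rewrite lerXn2r ?nnegrE//; lra.
Qed.

(** * The chain applied to the iterated Laplacians of u *)

Theorem mainTheorem6 (R : realType) (q : R) (hq : 2 <= q) :
  ~ exists u : 'rV[R]_4 -> R,
      [/\ Ck 6 u,
          (forall x, 0 < u x),
          (forall x, laplacian (laplacian (laplacian u)) x = u x `^ (- q)) &
          (* u(x) = o(|x|^4) as |x| -> +oo *)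
          (forall eps : R, 0 < eps -> exists M : R, forall x,
              M < enorm x -> `|u x| <= eps * enorm x ^+ 4)].
Proof.
move=> [u [C6 u0 eqn uo]].
have [L IL] := integral_like_exists R 4.
pose g j := iter j (@laplacian R 4) u.
have Cg j : (j < 3)%N -> Ck 2 (g j).
  have C4 := Ck_laplacian C6; have C2 := Ck_laplacian C4.
  case: j => [_|[_|[_|j jlt]]].
  - exact (CkS (CkS (CkS (CkS C6)))).
  - exact (CkS (CkS C4)).
  - exact C2.
  - discriminate jlt.
have cg j : (j <= 3)%N -> continuous (g j).
  rewrite leq_eqVlt => /predU1P[->|/Cg/Ck_continuous//].
  exact: Ck_continuous (Ck_laplacian (Cg 2%N isT)).
apply: (@radial_chain_absurd R (fun j => moment L 3 (g j))
  (fun j s => 3 * moment L 2 (g j) s / s ^+ 4)).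
- move=> j s j3 s0.
  have d := moment_derive IL s (isT : (0 < 2 < 3)%N) (cg j (ltnW j3)).
  by apply: is_derive_eq; field; exact: lt0r_neq0.
- move=> j s j3 s0.
  have d := moment_derive IL s (isT : (0 < 1 < 3)%N) (cg j (ltnW j3)).
  have sn0 : s != 0 by exact: lt0r_neq0.
  have s4n0 : (@id R ^+ 4) s != 0 by rewrite fctE expf_neq0.
  have dV := is_deriveV s4n0 (is_deriveX 4 (is_derive_id s (1 : R))).
  have dM := is_deriveM (is_deriveM (is_derive_cst (3 : R) s 1) d) dV.
  apply: (is_derive_eq dM).
  (* With M_k for [moment L k (g j) s], the derivative of 3 M_2 / s^4 is 6 M_1 / s^4 - 12 M_2 / s^5,
     which is (24 s M_1 - 48 M_2) / (4 s^5). *)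
  rewrite (moment_laplacian s IL (Cg j j3)) /GRing.scale/= !fctE.
  by field.
- move=> s; apply: (integral_like_ge0 IL).
    exact: bounded_support_pospow (cg 0%N isT).
  by move=> x; rewrite mulr_ge0 ?pospow_ge0// ltW.
- exact: moment_growth IL (cg 0%N isT) uo.
- apply: moment_positive_grows IL (cg 3%N isT) _ => x.
  by rewrite /g/= eqn powR_gt0.
Qed.
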